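(* Let $\Bbbk$ be a field with $\mathrm{char}(\Bbbk)\neq 2$, $n\ge 1$, let $A=Cl(\alpha,\beta_i,\gamma_i,\lambda_{ij})$ be a $2^{n+1}$-dimensional Clifford algebra with its canonical $E(n)$-comodule algebra structure, and let $\mathfrak{T}:E(n)\to A\otimes E(n)^{\mathrm{op}}$ be an integral on $(E(n),\psi)$. Let $\eta(\emptyset;k,Q)\in\Bbbk$ ($k\in\{0,1\}$, $Q\subseteq\{1,\dots,n\}$) be the scalars such that $$\mathfrak{T}(1_{E(n)})=\sum_{k,Q}\sum_{F\subseteq Q}\eta(\emptyset;k,Q)(-1)^{s(Q\setminus F,Q)+(|Q|+k)|F|}G^kX_{Q\setminus F}\otimes g^{|Q|+k}x_F.$$ Then $\mathfrak{T}$ is a total integral on $(E(n),\psi)$ if and only if $\eta(\emptyset;0,\emptyset)=1$ and $\eta(\emptyset;k,Q)=0$ for $(k,Q)\neq(0,\emptyset)$.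
   Context: Everything is over a field $\Bbbk$ with $\mathrm{char}(\Bbbk)\ne2$; $\otimes=\otimes_\Bbbk$; Sweedler notation with suppressed summation is used. $E(n)$ is the $2^{n+1}$-dimensional Hopf algebra generated by $g,x_1,\dots,x_n$ with $g^2=1$, $x_i^2=0$, $gx_i=-x_ig$, $x_ix_j=-x_jx_i$ ($i<j$), $\Delta(g)=g\otimes g$, $\varepsilon(g)=1$, $S(g)=g$, $\Delta(x_i)=x_i\otimes g+1\otimes x_i$, $\varepsilon(x_i)=0$, $S(x_i)=gx_i$. It has a bijective antipode. For $P=\{i_1<\dots<i_s\}\subseteq\{1,\dots,n\}$ put $x_P=x_{i_1}\cdots x_{i_s}$, $x_\emptyset=1$; the elements $g^jx_P$ ($j\in\{0,1\}$) form a basis. $Cl(\alpha,\beta_i,\gamma_i,\lambda_{ij})$, for fixed scalars $\alpha,\beta_i,\gamma_i$ ($1\le i\le n$), $\lambda_{ij}$ ($i<j$) in $\Bbbk$, is the unital associative algebra generated by $G,X_1,\dots,X_n$ with $G^2=\alpha$, $X_i^2=\beta_i$, $GX_i+X_iG=\gamma_i$, $X_iX_j+X_jX_i=\lambda_{ij}$ ($i<j$); it has basis $G^jX_P$ ($j\in\{0,1\}$, $P\subseteq\{1,\dots,n\}$), with $X_P=X_{i_1}\cdots X_{i_s}$. Its canonical $E(n)$-comodule algebra structure is the algebra map $\rho$ with $\rho(G)=G\otimes g$, $\rho(X_i)=X_i\otimes g+1_A\otimes x_i$. Signs: for $P=\{i_1<\dots<i_s\}$ and $F=\{i_{j_1},\dots,i_{j_r}\}\subseteq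 P$, $s(F,P):=(j_1+\dots+j_r)-\frac{r(r+1)}2$, and $s(\emptyset,P):=0$. For a Hopf algebra $H$ and right $H$-comodule algebra $(A,\rho)$, $\rho(a)=a_0\otimes a_1$, the cowreath $(A\otimes H^{\mathrm{op}},H,\psi)$ has $\psi(h\otimes a\otimes l)=a_0\otimes l_1\otimes l_2ha_1$. Convention: products written without symbol in $A\otimes H$ use the ordinary multiplications of $A$ and $H$ (not the opposite one). An integral on $(H,\psi)$ is a $\Bbbk$-linear map $\mathfrak{T}:H\to A\otimes H^{\mathrm{op}}$, $\mathfrak{T}(h)=\mathfrak{T}^A(h)\otimes\mathfrak{T}^H(h)$, such that for all $a\in A,h\in H$: $$\mathfrak{T}^A(h_2)_0\otimes \mathfrak{T}^H(h_2)_1\otimes \mathfrak{T}^H(h_2)_2h_1\mathfrak{T}^A(h_2)_1=\mathfrak{T}(h)\otimes 1_H,$$ $$(a_0\otimes 1_H)\mathfrak{T}(S^{-1}(a_2)ha_1)(1_A\otimes S^{-1}(a_3))=(1_A\otimes S^{-1}(a_1))\mathfrak{T}(h)(a_0\otimes 1_H).$$ It is total if $\mathfrak{T}(1_H)=1_A\otimes 1_H$. For every integral on $(E(n),\psi)$ the value $\mathfrak{T}(1_{E(n)})$ can be written, for unique scalars $\eta(\emptyset;k,Q)$, in the form displayed in the claim. *)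

(* Defs.v *)
From HB Require Import structures.
From mathcomp Require Import all_boot all_order all_algebra.
From mathcomp Require Import boolp classical_sets.

Set Implicit Arguments.
Unset Strict Implicit.
Unset Printing Implicit Defensive.

Import GRing.Theory.
Local Open Scope ring_scope.
Local Open Scope quotient_scope.

Section Tensor.
Variables (K : fieldType) (U V : lmodType K).

(* A sequence of pairs stands for the formal sum of the u (x) v. *)
Inductive tensor_eq : seq (U * V) -> seq (U * V) -> Prop :=
| teq_refl s : tensor_eq s s
| teq_sym s t : tensor_eq s t -> tensor_eq t s
| teq_trans s t r : tensor_eq s t -> tensor_eq t r -> tensor_eq s r
| teq_cat s s' t t' :
    tensor_eq s s' -> tensor_eq t t' -> tensor_eq (s ++ t) (s' ++ t')
| teq_catC s t : tensor_eq (s ++ t) (t ++ s)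
| teq_Dl u u' v : tensor_eq [:: (u + u', v)] [:: (u, v); (u', v)]
| teq_Dr u v v' : tensor_eq [:: (u, v + v')] [:: (u, v); (u, v')]
| teq_Z c u v : tensor_eq [:: (c *: u, v)] [:: (u, c *: v)]
| teq_0 v : tensor_eq [:: (0, v)] [::].

Definition tensor_eqb (s t : seq (U * V)) : bool := `[< tensor_eq s t >].

Lemma tensor_eqb_equiv : equiv_class_of tensor_eqb.
Proof.
split.
- by move=> s; apply/asboolP; apply: teq_refl.
- by move=> s t; apply/asboolP/asboolP; apply: teq_sym.
- by move=> s t r /asboolP st /asboolP tr; apply/asboolP; apply: teq_trans tr.
Qed.

Canonical tensor_equiv := EquivRelPack tensor_eqb_equiv.

Definition tensor : Type := {eq_quot tensor_equiv}.
HB.instance Definition _ := Choice.on tensor.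
HB.instance Definition _ := EqQuotient.on tensor.

Definition tsum (s : seq (U * V)) : tensor := \pi_tensor s.

Definition tens (u : U) (v : V) : tensor := tsum [:: (u, v)].

Lemma tsumP s t : tsum s = tsum t <-> tensor_eq s t.
Proof.
by split=> [/eqmodP/asboolP|st] //; apply/eqmodP/asboolP.
Qed.

Lemma tsum_repr (t : tensor) : tsum (repr t) = t.
Proof. exact: reprK. Qed.

Lemma repr_tsum s : tensor_eq (repr (tsum s)) s.
Proof. by apply/tsumP; rewrite tsum_repr. Qed.

Lemma teq_scale c s t : tensor_eq s t ->
  tensor_eq [seq (c *: p.1, p.2) | p <- s] [seq (c *: p.1, p.2) | p <- t].
Proof.
elim=> {s t} /=.
- by move=> s; apply: teq_refl.
- by move=> s t _; apply: teq_sym.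
- by move=> s t r _ st _; apply: teq_trans.
- by move=> s s' t t' _ ss' _ tt'; rewrite !map_cat; apply: teq_cat.
- by move=> s t; rewrite !map_cat; apply: teq_catC.
- by move=> u u' v; rewrite scalerDr; apply: teq_Dl.
- by move=> u v v'; apply: teq_Dr.
- by move=> d u v; rewrite scalerA mulrC -scalerA; apply: teq_Z.
- by move=> v; rewrite scaler0; apply: teq_0.
Qed.

Definition tens_add (x y : tensor) : tensor := tsum (repr x ++ repr y).
Definition tens_scale (c : K) (x : tensor) : tensor :=
  tsum [seq (c *: p.1, p.2) | p <- repr x].

Lemma tens_addE s t : tens_add (tsum s) (tsum t) = tsum (s ++ t).
Proof. by apply/tsumP; apply: teq_cat; apply: repr_tsum. Qed.

Lemma tens_scaleE c s :
  tens_scale c (tsum s) = tsum [seq (c *: p.1, p.2) | p <- s].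
Proof.
by apply/tsumP/teq_scale/repr_tsum.
Qed.

Fact tens_addA : associative tens_add.
Proof.
move=> x y z; rewrite -[x]tsum_repr -[y]tsum_repr -[z]tsum_repr.
by rewrite !tens_addE catA.
Qed.

Fact tens_addC : commutative tens_add.
Proof. by move=> x y; apply/tsumP; apply: teq_catC. Qed.

Fact tens_add0 : left_id (tsum [::]) tens_add.
Proof. by move=> x; rewrite -[x]tsum_repr tens_addE. Qed.

Fact tens_addN : left_inverse (tsum [::]) (tens_scale (-1)) tens_add.
Proof.
move=> x; rewrite -[x]tsum_repr tens_scaleE tens_addE.
elim: (repr x) => [//|[u v] s IHs] /=.
have -> : tsum ((-1 *: u, v) :: [seq (-1 *: p.1, p.2) | p <- s] ++ (u, v) :: s) =
  tsum ([:: (-1 *: u, v)] ++ [:: (u, v)] ++ [seq (-1 *: p.1, p.2) | p <- s] ++ s).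
  apply/tsumP; apply: (teq_cat (teq_refl [:: (-1 *: u, v)])).
  by rewrite -[_ :: s]cat1s !catA; apply: teq_cat (teq_catC _ _) (teq_refl _).
rewrite catA -tens_addE IHs [RHS](_ : _ = tens_add (tsum [::]) (tsum [::])).
  congr tens_add; apply/tsumP; apply: teq_trans (teq_0 v).
  by rewrite -[X in tensor_eq _ [:: (X, _)]](addNr u) -scaleN1r; apply/teq_sym/teq_Dl.
by rewrite tens_add0.
Qed.

HB.instance Definition _ :=
  GRing.isZmodule.Build tensor tens_addA tens_addC tens_add0 tens_addN.

Lemma tsum_nil : tsum [::] = 0. Proof. by []. Qed.

Lemma tsum_cons p s : tsum (p :: s) = tens p.1 p.2 + tsum s.
Proof. by rewrite [RHS]tens_addE -surjective_pairing. Qed.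

Lemma tensDl u u' v : tens (u + u') v = tens u v + tens u' v.
Proof. by rewrite [RHS]tens_addE; apply/tsumP; apply: teq_Dl. Qed.

Lemma tensDr u v v' : tens u (v + v') = tens u v + tens u v'.
Proof. by rewrite [RHS]tens_addE; apply/tsumP; apply: teq_Dr. Qed.

Fact tens_scaleA a b x : tens_scale a (tens_scale b x) = tens_scale (a * b) x.
Proof.
rewrite -[x]tsum_repr !tens_scaleE -map_comp; congr tsum.
by apply: eq_map => p /=; rewrite scalerA.
Qed.

Fact tens_scale1 : left_id 1 tens_scale.
Proof.
move=> x; rewrite -[x]tsum_repr tens_scaleE; congr tsum.
by rewrite -[RHS]map_id; apply: eq_map => -[u v] /=; rewrite scale1r.
Qed.

Fact tens_scaleDr : right_distributive tens_scale +%R.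
Proof.
move=> c x y; rewrite -[x]tsum_repr -[y]tsum_repr [X in tens_scale _ X]tens_addE.
by rewrite !tens_scaleE map_cat [RHS]tens_addE.
Qed.

Fact tens_scaleDl x : {morph tens_scale^~ x : a b / a + b}.
Proof.
move=> a b; rewrite -[x]tsum_repr !tens_scaleE.
elim: (repr x) => [|[u v] s IHs] /=; first by rewrite addr0.
by rewrite !tsum_cons IHs /= scalerDl tensDl addrACA.
Qed.

HB.instance Definition _ := GRing.Zmodule_isLmodule.Build K tensor
  tens_scaleA tens_scale1 tens_scaleDr tens_scaleDl.

Lemma tensZl c u v : tens (c *: u) v = c *: tens u v.
Proof. by rewrite [RHS]tens_scaleE. Qed.

Lemma tensZr c u v : tens u (c *: v) = c *: tens u v.
Proof. by rewrite -tensZl; apply/esym/tsumP; apply: teq_Z. Qed.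

Lemma tsumE s : tsum s = \sum_(p <- s) tens p.1 p.2.
Proof.
by elim: s => [|p s IHs]; rewrite ?big_nil // big_cons tsum_cons IHs.
Qed.

Lemma tensorE t : t = \sum_(p <- repr t) tens p.1 p.2.
Proof. by rewrite -tsumE tsum_repr. Qed.

Lemma tensor_ind (P : tensor -> Prop) :
  P 0 -> (forall s t, P s -> P t -> P (s + t)) -> (forall u v, P (tens u v)) ->
  forall t, P t.
Proof.
by move=> P0 PD Pt t; rewrite [t]tensorE; elim/big_rec: _ => // p s _; apply: PD.
Qed.

(* Sweedler notation: for t = \sum_i u_i (x) v_i, tlift f t is
   \sum_i f u_i v_i, which by [tliftE] and [tlift_is_linear] does not depend on
   the way t is written as soon as f is bilinear. *)
Definition tlift (W : nmodType) (f : U -> V -> W) (t : tensor) : W :=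
  \sum_(p <- repr t) f p.1 p.2.

Definition bilinear_map (W : lmodType K) (f : U -> V -> W) : Prop :=
  (forall v, linear (f^~ v)) /\ (forall u, linear (f u)).

Section Lift.
Variables (W : lmodType K) (f : U -> V -> W) (bf : bilinear_map f).

Let fDl u u' v : f (u + u') v = f u v + f u' v.
Proof. by have := bf.1 v 1 u u'; rewrite !scale1r. Qed.
Let fDr u v v' : f u (v + v') = f u v + f u v'.
Proof. by have := bf.2 u 1 v v'; rewrite !scale1r. Qed.
Let f0l v : f 0 v = 0.
Proof. by apply: (addrI (f 0 v)); rewrite -fDl !addr0. Qed.
Let f0r u : f u 0 = 0.
Proof. by apply: (addrI (f u 0)); rewrite -fDr !addr0. Qed.
Let fZl c u v : f (c *: u) v = c *: f u v.
Proof. by have := bf.1 v c u 0; rewrite !addr0 f0l addr0. Qed.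
Let fZr c u v : f u (c *: v) = c *: f u v.
Proof. by have := bf.2 u c v 0; rewrite !addr0 f0r addr0. Qed.

Let sum_teq s t : tensor_eq s t ->
  \sum_(p <- s) f p.1 p.2 = \sum_(p <- t) f p.1 p.2.
Proof.
elim=> {s t} //=.
- by move=> s t r _ -> _ ->.
- by move=> s s' t t' _ ss' _ tt'; rewrite !big_cat /= ss' tt'.
- by move=> s t; rewrite !big_cat /= addrC.
- by move=> u u' v; rewrite !big_cons !big_nil /= !addr0.
- by move=> u v v'; rewrite !big_cons !big_nil /= !addr0.
- by move=> c u v; rewrite !big_cons !big_nil /= fZl fZr.
- by move=> v; rewrite big_cons !big_nil /= f0l addr0.
Qed.

Lemma tlift_tsum s : tlift f (tsum s) = \sum_(p <- s) f p.1 p.2.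
Proof. exact/sum_teq/repr_tsum. Qed.

Lemma tliftE u v : tlift f (tens u v) = f u v.
Proof. by rewrite tlift_tsum big_cons big_nil addr0. Qed.

Lemma tlift_is_linear : linear (tlift f).
Proof.
move=> c s t; rewrite -[s]tsum_repr -[t]tsum_repr.
rewrite [X in tlift f (X + _)]tens_scaleE [X in tlift f X]tens_addE !tlift_tsum.
rewrite big_cat /= big_map scaler_sumr; congr (_ + _).
by apply: eq_bigr => p _; rewrite fZl.
Qed.
End Lift.
End Tensor.

Arguments tens {K U V} u v.

Notation "U ⊗ V" := (tensor U%type V%type) (at level 45, right associativity) : type_scope.
Notation "u ⊗ v" := (tens u v) (at level 45, right associativity) : ring_scope.

Lemma tens_bilinear (K : fieldType) (U V : lmodType K) :
  bilinear_map (@tens K U V).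
Proof.
by split=> [v c u u'|u c v v']; rewrite ?tensDl ?tensDr ?tensZl ?tensZr.
Qed.

Section LiftLinear.
Variables (K : fieldType) (U V W : lmodType K).

Lemma bilinear_mapP (f : U -> V -> W) :
  (forall u u' v, f (u + u') v = f u v + f u' v) ->
  (forall u v v', f u (v + v') = f u v + f u v') ->
  (forall c u v, f (c *: u) v = c *: f u v) ->
  (forall c u v, f u (c *: v) = c *: f u v) -> bilinear_map f.
Proof. by move=> Dl Dr Zl Zr; split=> [v c u u'|u c v v']; rewrite ?Dl ?Dr ?Zl ?Zr. Qed.

Variables (f : U -> V -> W) (bf : bilinear_map f).

Lemma tliftD s t : tlift f (s + t) = tlift f s + tlift f t.
Proof. by have := tlift_is_linear bf 1 s t; rewrite !scale1r. Qed.

Lemma tlift0 : tlift f 0 = 0.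
Proof. by apply: (addrI (tlift f 0)); rewrite -tliftD !addr0. Qed.

Lemma tliftZ c t : tlift f (c *: t) = c *: tlift f t.
Proof. by have := tlift_is_linear bf c t 0; rewrite tlift0 !addr0. Qed.
End LiftLinear.

Lemma eq_tlift (K : fieldType) (U V : lmodType K) (W : nmodType)
    (f g : U -> V -> W) t : (forall u v, f u v = g u v) -> tlift f t = tlift g t.
Proof. by move=> fg; apply: eq_bigr => p _; apply: fg. Qed.

Lemma tlift_addf (K : fieldType) (U V : lmodType K) (W : nmodType)
    (f g : U -> V -> W) t :
  tlift (fun u v => f u v + g u v) t = tlift f t + tlift g t.
Proof. exact: big_split. Qed.

Lemma tlift_scalef (K : fieldType) (U V W : lmodType K) c (f : U -> V -> W) t :
  tlift (fun u v => c *: f u v) t = c *: tlift f t.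
Proof. by rewrite /tlift scaler_sumr. Qed.

Section TensZero.
Variables (K : fieldType) (U V : lmodType K).
Implicit Types (u : U) (v : V).
Lemma tens0l v : (0 : U) ⊗ v = 0.
Proof. by rewrite -(scale0r (0 : U)) tensZl scale0r. Qed.
Lemma tens0r u : u ⊗ (0 : V) = 0.
Proof. by rewrite -(scale0r (0 : V)) tensZr scale0r. Qed.
Lemma tensNl u v : (- u) ⊗ v = - (u ⊗ v).
Proof. by rewrite -scaleN1r tensZl scaleN1r. Qed.
Lemma tensNr u v : u ⊗ (- v) = - (u ⊗ v).
Proof. by rewrite -scaleN1r tensZr scaleN1r. Qed.
End TensZero.

(* Any nonzero vector is separated from 0 by a linear form; this makes a tensor
   product of nonzero algebras nonzero. *)
Section Separation.
Local Open Scope classical_set_scope.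
Variables (K : fieldType) (V : lmodType K) (e : V).

Let subsp (A : set V) :=
  (forall c u v, A u -> A v -> A (c *: u + v)) /\ ~ A e.

Lemma linear_form_exists :
  e != 0 -> exists f : V -> K^o, linear f /\ f e = 1.
Proof.
move=> e0.
have [|N [[NL Ne] Nmax]] := @Zorn_bigcup V subsp.
  move=> F FS Ftot; split=> [c u v [A FA Au] [B FB Bv]|[A FA Ae]]; last first.
    by have [_] := FS _ FA.
  have [AB|BA] := Ftot _ _ FA FB.
    by exists B => //; apply: (FS _ FB).1 => //; apply: AB.
  by exists A => //; apply: (FS _ FA).1 => //; apply: BA.
have N0 : N 0.
  apply: contrapT => N0; apply: (Nmax [set 0]) => [|]; last first.
    split=> [c u v /= -> ->|/= /eqP]; last by rewrite (negbTE e0).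
    by rewrite scaler0 addr0.
  split=> [u Nu|sub]; last by apply: N0; apply: sub.
  by case: N0; have := NL (-1) u u Nu Nu; rewrite scaleN1r addNr.
have NZ c u : N u -> N (c *: u).
  by move=> Nu; have := NL c u 0 Nu N0; rewrite addr0.
have ND u v : N u -> N v -> N (u + v).
  by move=> Nu Nv; have := NL 1 u v Nu Nv; rewrite scale1r.
have dec v : exists c : K, N (v - c *: e).
  apply: contrapT => Nv.
  apply: (Nmax [set w | exists2 c, N (w - c *: v) & True]).
    split=> [u Nu|sub]; first by exists 0 => //; rewrite scale0r subr0.
    apply: Nv; exists 0; rewrite scale0r subr0; apply: sub.
    by exists 1 => //; rewrite scale1r subrr.
  split=> [c u w [a Na _] [b Nb _]|[c Nc _]].
    exists (c * a + b) => //.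
    by have := NL c _ _ Na Nb; rewrite scalerBr addrACA -opprD scalerA -scalerDl.
  have [c0|c0] := eqVneq c 0; first by case: Ne; rewrite c0 scale0r subr0 in Nc.
  apply: Nv; exists c^-1; have := NZ (- c^-1) _ Nc.
  by rewrite scalerBr !scaleNr opprK scalerA mulVf // scale1r addrC.
have uniqc v c d : N (v - c *: e) -> N (v - d *: e) -> c = d.
  move=> Nc Nd; apply/eqP; rewrite -subr_eq0; apply: contrapT => cd.
  apply: Ne; have := NZ (c - d)^-1 _ (NL (-1) _ _ Nc Nd).
  rewrite scaleN1r opprB addrA subrK -scalerBl scalerA.
  by rewrite mulVf ?scale1r //; apply/negP.
have [f fP] := choice dec.
exists f; split=> [c u v|].
  apply: (uniqc (c *: u + v)) => //.
  have := NL c _ _ (fP u) (fP v).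
  by rewrite scalerBr addrACA -opprD scalerA -scalerDl.
by apply: (uniqc e) => //; rewrite scale1r subrr.
Qed.
End Separation.

Section TensorAlgebra.
Variables (K : fieldType) (A B : algType K).
Implicit Types (s t : A ⊗ B).

Definition tmul s t : A ⊗ B :=
  tlift (fun a b => tlift (fun a' b' => (a * a') ⊗ (b * b')) t) s.

Let bil1 a b : bilinear_map (fun a' b' => (a * a') ⊗ (b * b') : A ⊗ B).
Proof.
by apply: bilinear_mapP => *; rewrite ?mulrDr ?tensDl ?tensDr // -scalerAr
  ?tensZl ?tensZr.
Qed.

Let bil2 t :
  bilinear_map (fun a b => tlift (fun a' b' => (a * a') ⊗ (b * b')) t : A ⊗ B).
Proof.
apply: bilinear_mapP => *; rewrite -?tlift_addf -?tlift_scalef; apply: eq_tlift => *.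
- by rewrite mulrDl tensDl.
- by rewrite mulrDl tensDr.
- by rewrite -scalerAl tensZl.
- by rewrite -scalerAl tensZr.
Qed.

Lemma tmulE a b a' b' : tmul (a ⊗ b) (a' ⊗ b') = (a * a') ⊗ (b * b').
Proof. by rewrite /tmul tliftE // tliftE. Qed.

Fact tmulDl : left_distributive tmul +%R.
Proof. by move=> s s' t; rewrite /tmul tliftD. Qed.

Fact tmulDr : right_distributive tmul +%R.
Proof.
by move=> s t t'; rewrite /tmul -tlift_addf; apply: eq_tlift => *; rewrite tliftD.
Qed.

Fact tmulZl c s t : c *: tmul s t = tmul (c *: s) t.
Proof. by rewrite /tmul tliftZ. Qed.

Fact tmulZr c s t : c *: tmul s t = tmul s (c *: t).
Proof.
by rewrite /tmul -tlift_scalef; apply: eq_tlift => *; rewrite tliftZ.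
Qed.

Fact tmul0l t : tmul 0 t = 0. Proof. by rewrite /tmul tlift0. Qed.
Fact tmul0r s : tmul s 0 = 0.
Proof. by apply: (addrI (tmul s 0)); rewrite -tmulDr !addr0. Qed.

Fact tmulA : associative tmul.
Proof.
move=> s t r; elim/tensor_ind: s => [|s s' IH IH'|a b].
- by rewrite !tmul0l.
- by rewrite !tmulDl IH IH'.
elim/tensor_ind: t => [|t t' IH IH'|a' b'].
- by rewrite !(tmul0l, tmul0r).
- by rewrite !(tmulDl, tmulDr) IH IH'.
elim/tensor_ind: r => [|r r' IH IH'|a'' b''].
- by rewrite !tmul0r.
- by rewrite !tmulDr IH IH'.
by rewrite !tmulE !mulrA.
Qed.

Fact tmul1l : left_id (1 ⊗ 1) tmul.
Proof.
elim/tensor_ind => [|s s' IH IH'|a b]; first exact: tmul0r.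
  by rewrite tmulDr IH IH'.
by rewrite tmulE !mul1r.
Qed.

Fact tmul1r : right_id (1 ⊗ 1) tmul.
Proof.
elim/tensor_ind => [|s s' IH IH'|a b]; first exact: tmul0l.
  by rewrite tmulDl IH IH'.
by rewrite tmulE !mulr1.
Qed.

Fact tone_neq0 : (1 : A) ⊗ (1 : B) != 0.
Proof.
have [f [fL f1]] := linear_form_exists (oner_neq0 A).
have [g [gL g1]] := linear_form_exists (oner_neq0 B).
have bfg : bilinear_map (fun a b => f a * g b : K^o).
  split=> [b c a a'|a c b b']; rewrite ?fL ?gL ?mulrDl ?mulrDr //.
    by rewrite -scalerAl.
  by rewrite -scalerAr.
apply/eqP => /(congr1 (tlift (fun a b => f a * g b : K^o))).
rewrite tliftE // tlift0 // f1 g1 mulr1; exact/eqP/oner_neq0.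
Qed.

HB.instance Definition _ := GRing.Zmodule_isNzRing.Build (A ⊗ B)%type
  tmulA tmul1l tmul1r tmulDl tmulDr tone_neq0.
HB.instance Definition _ := GRing.Lmodule_isLalgebra.Build K (A ⊗ B)%type tmulZl.
HB.instance Definition _ := GRing.Lalgebra_isAlgebra.Build K (A ⊗ B)%type tmulZr.

Lemma tensM (a a' : A) (b b' : B) :
  (a ⊗ b) * (a' ⊗ b') = (a * a') ⊗ (b * b').
Proof. exact: tmulE. Qed.

Lemma tens1 : 1 = 1 ⊗ 1 :> A ⊗ B. Proof. by []. Qed.
End TensorAlgebra.


Section Converse.
Variables (K : fieldType) (A : algType K).
HB.instance Definition _ := GRing.Zmodule_isLmodule.Build K A^c
  (@scalerA K A) (@scale1r K A) (@scalerDr K A) (@scalerDl K A).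
Fact conv_scaleAl (c : K) (x y : A^c) : c *: (x * y) = ((c *: x) : A^c) * y.
Proof. exact: (@scalerAr K A c y x). Qed.
Fact conv_scaleAr (c : K) (x y : A^c) : c *: (x * y) = x * ((c *: y) : A^c).
Proof. exact: (@scalerAl K A c y x). Qed.
HB.instance Definition _ := GRing.Lmodule_isLalgebra.Build K A^c conv_scaleAl.
HB.instance Definition _ := GRing.Lalgebra_isAlgebra.Build K A^c conv_scaleAr.
End Converse.

(* Noncommutative polynomial expressions in the letters I. *)
Inductive aterm (K I : Type) : Type :=
| AConst of K
| AGen of I
| AAdd of aterm K I & aterm K I
| AMul of aterm K I & aterm K I.
Arguments AConst {K I}.
Arguments AGen {K I}.
HB.instance Definition _ K I := gen_eqMixin (aterm K I).
HB.instance Definition _ K I := gen_choiceMixin (aterm K I).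

(* The unital associative K-algebra with generators I and relations rel. *)
Section Presented.
Variables (K : fieldType) (I : Type) (rel : aterm K I -> aterm K I -> Prop).
Notation term := (aterm K I).

Inductive aeq : term -> term -> Prop :=
| aeq_rel s t : rel s t -> aeq s t
| aeq_refl s : aeq s s
| aeq_sym s t : aeq s t -> aeq t s
| aeq_trans s t r : aeq s t -> aeq t r -> aeq s r
| aeq_add s s' t t' : aeq s s' -> aeq t t' -> aeq (AAdd s t) (AAdd s' t')
| aeq_mul s s' t t' : aeq s s' -> aeq t t' -> aeq (AMul s t) (AMul s' t')
| aeq_addA s t r : aeq (AAdd s (AAdd t r)) (AAdd (AAdd s t) r)
| aeq_addC s t : aeq (AAdd s t) (AAdd t s)
| aeq_add0 s : aeq (AAdd (AConst 0) s) s
| aeq_mulA s t r : aeq (AMul s (AMul t r)) (AMul (AMul s t) r)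
| aeq_mul1l s : aeq (AMul (AConst 1) s) s
| aeq_mulDl s t r : aeq (AMul (AAdd s t) r) (AAdd (AMul s r) (AMul t r))
| aeq_mulDr s t r : aeq (AMul r (AAdd s t)) (AAdd (AMul r s) (AMul r t))
| aeq_constD c d : aeq (AAdd (AConst c) (AConst d)) (AConst (c + d))
| aeq_constM c d : aeq (AMul (AConst c) (AConst d)) (AConst (c * d))
| aeq_constC c s : aeq (AMul (AConst c) s) (AMul s (AConst c))
| aeq_const0 s : aeq (AMul (AConst 0) s) (AConst 0).

Definition aeqb (s t : term) : bool := `[< aeq s t >].

Lemma aeqb_equiv : equiv_class_of aeqb.
Proof.
split.
- by move=> s; apply/asboolP; apply: aeq_refl.
- by move=> s t; apply/asboolP/asboolP; apply: aeq_sym.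
- by move=> s t r /asboolP st /asboolP tr; apply/asboolP; apply: aeq_trans tr.
Qed.

Canonical aeq_equiv := EquivRelPack aeqb_equiv.

Definition presented : Type := {eq_quot aeq_equiv}.
HB.instance Definition _ := Choice.on presented.
HB.instance Definition _ := EqQuotient.on presented.

Definition pcls (s : term) : presented := \pi_presented s.

Lemma pclsP s t : pcls s = pcls t <-> aeq s t.
Proof. by split=> [/eqmodP/asboolP|st] //; apply/eqmodP/asboolP. Qed.

Lemma pcls_repr (x : presented) : pcls (repr x) = x.
Proof. exact: reprK. Qed.

Lemma repr_pcls s : aeq (repr (pcls s)) s.
Proof. by apply/pclsP; rewrite pcls_repr. Qed.

Definition padd (x y : presented) := pcls (AAdd (repr x) (repr y)).
Definition pmul (x y : presented) := pcls (AMul (repr x) (repr y)).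
Definition pconst (c : K) : presented := pcls (AConst c).
Definition pgen (i : I) : presented := pcls (AGen i).
Definition pscale c x := pmul (pconst c) x.

Lemma paddE s t : padd (pcls s) (pcls t) = pcls (AAdd s t).
Proof. by apply/pclsP; apply: aeq_add; apply: repr_pcls. Qed.

Lemma pmulE s t : pmul (pcls s) (pcls t) = pcls (AMul s t).
Proof. by apply/pclsP; apply: aeq_mul; apply: repr_pcls. Qed.

Let pE := (paddE, pmulE).

Fact paddA : associative padd.
Proof.
move=> x y z; rewrite -[x]pcls_repr -[y]pcls_repr -[z]pcls_repr !pE.
exact/pclsP/aeq_addA.
Qed.

Fact paddC : commutative padd.
Proof.
by move=> x y; rewrite -[x]pcls_repr -[y]pcls_repr !pE; apply/pclsP/aeq_addC.
Qed.

Fact padd0 : left_id (pconst 0) padd.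
Proof. by move=> x; rewrite -[x]pcls_repr !pE; apply/pclsP/aeq_add0. Qed.

Fact pmulA : associative pmul.
Proof.
move=> x y z; rewrite -[x]pcls_repr -[y]pcls_repr -[z]pcls_repr !pE.
exact/pclsP/aeq_mulA.
Qed.

Fact pmul1l : left_id (pconst 1) pmul.
Proof. by move=> x; rewrite -[x]pcls_repr !pE; apply/pclsP/aeq_mul1l. Qed.

Fact pconstC c x : pmul (pconst c) x = pmul x (pconst c).
Proof. by rewrite -[x]pcls_repr !pE; apply/pclsP/aeq_constC. Qed.

Fact pmul1r : right_id (pconst 1) pmul.
Proof. by move=> x; rewrite -pconstC pmul1l. Qed.

Fact pmulDl : left_distributive pmul padd.
Proof.
move=> x y z; rewrite -[x]pcls_repr -[y]pcls_repr -[z]pcls_repr !pE.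
exact/pclsP/aeq_mulDl.
Qed.

Fact pmulDr : right_distributive pmul padd.
Proof.
move=> x y z; rewrite -[x]pcls_repr -[y]pcls_repr -[z]pcls_repr !pE.
exact/pclsP/aeq_mulDr.
Qed.

Fact pconstD c d : pconst (c + d) = padd (pconst c) (pconst d).
Proof. by rewrite !pE; apply/esym/pclsP/aeq_constD. Qed.

Fact pconstM c d : pconst (c * d) = pmul (pconst c) (pconst d).
Proof. by rewrite !pE; apply/esym/pclsP/aeq_constM. Qed.

Fact paddN : left_inverse (pconst 0) (pscale (-1)) padd.
Proof.
move=> x; rewrite -{2}[x]pmul1l -pmulDl -pconstD addNr -[x]pcls_repr !pE.
exact/pclsP/aeq_const0.
Qed.

HB.instance Definition _ :=
  GRing.isZmodule.Build presented paddA paddC padd0 paddN.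
HB.instance Definition _ := GRing.Zmodule_isPzRing.Build presented
  pmulA pmul1l pmul1r pmulDl pmulDr.

Fact pscaleA a b x : pscale a (pscale b x) = pscale (a * b) x.
Proof. by rewrite /pscale pconstM pmulA. Qed.

Fact pscaleDl x : {morph pscale^~ x : a b / a + b}.
Proof. by move=> a b; rewrite /pscale pconstD pmulDl. Qed.

HB.instance Definition _ := GRing.Zmodule_isLmodule.Build K presented
  pscaleA pmul1l (fun c => @pmulDr (pconst c)) pscaleDl.

Fact pscaleAl c (x y : presented) : c *: (x * y) = (c *: x) * y.
Proof. exact: mulrA. Qed.

Fact pscaleAr c (x y : presented) : c *: (x * y) = x * (c *: y).
Proof.
rewrite -[LHS]/(pmul _ (pmul _ _)) -[RHS]/(pmul _ (pmul _ _)).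
by rewrite pmulA pconstC -pmulA.
Qed.

Lemma presented_ind (P : presented -> Prop) :
  P 1 -> (forall i, P (pgen i)) -> (forall c x, P x -> P (c *: x)) ->
  (forall x y, P x -> P y -> P (x + y)) ->
  (forall x y, P x -> P y -> P (x * y)) -> forall x, P x.
Proof.
move=> P1 Pg PZ PD PM x; rewrite -[x]pcls_repr.
elim: (repr x) => [c|i|s IHs t IHt|s IHs t IHt] //.
- suff -> : pcls (AConst c) = c *: (1 : presented) by apply: PZ.
  by apply/esym/pmul1r.
- exact: Pg.
- by rewrite -paddE; apply: PD.
- by rewrite -pmulE; apply: PM.
Qed.

Section Lift.
Variables (B : algType K) (f : I -> B).

Fixpoint aeval (s : term) : B :=
  match s with
  | AConst c => c%:A
  | AGen i => f i
  | AAdd s t => aeval s + aeval t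
  | AMul s t => aeval s * aeval t
  end.

Definition plift (x : presented) : B := aeval (repr x).

Hypothesis frel : forall s t, rel s t -> aeval s = aeval t.

Lemma aeval_aeq s t : aeq s t -> aeval s = aeval t.
Proof.
elim=> {s t} /=.
- exact: frel.
- by [].
- by [].
- by move=> s t r _ -> _ ->.
- by move=> s s' t t' _ -> _ ->.
- by move=> s s' t t' _ -> _ ->.
- by move=> *; rewrite addrA.
- by move=> *; rewrite addrC.
- by move=> *; rewrite scale0r add0r.
- by move=> *; rewrite mulrA.
- by move=> *; rewrite scale1r mul1r.
- by move=> *; rewrite mulrDl.
- by move=> *; rewrite mulrDr.
- by move=> *; rewrite scalerDl.
- by move=> *; rewrite -scalerAl mul1r scalerA.
- by move=> *; rewrite -scalerAl mul1r -scalerAr mulr1.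
- by move=> *; rewrite !scale0r mul0r.
Qed.

Lemma plift_cls s : plift (pcls s) = aeval s.
Proof. exact/aeval_aeq/repr_pcls. Qed.

Lemma plift_gen i : plift (pgen i) = f i.
Proof. exact: plift_cls. Qed.

Lemma pliftD x y : plift (x + y) = plift x + plift y.
Proof. exact: plift_cls. Qed.

Lemma pliftM x y : plift (x * y) = plift x * plift y.
Proof. exact: plift_cls. Qed.

Lemma plift1 : plift 1 = 1.
Proof. by rewrite plift_cls /= scale1r. Qed.

Lemma pliftZ c x : plift (c *: x) = c *: plift x.
Proof. by rewrite pliftM plift_cls /= -scalerAl mul1r. Qed.
End Lift.
End Presented.

(* Matrices with prescribed squares q i and anticommutators b i j (i < j), used
   to see that Clifford algebras are nonzero. *)
Section MatrixModel.
Variable K : fieldType.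

Fixpoint mdim (m : nat) : nat := if m is m'.+1 then (mdim m' + (mdim m').+1)%N else 0.

Fixpoint mmodel (m : nat) (q : nat -> K) (b : nat -> nat -> K) (i : nat) :
    'M[K]_((mdim m).+1) :=
  if m is m'.+1 then
    if i is i'.+1 then
      let E := mmodel m' (q \o succn) (fun i j => b i.+1 j.+1) i' in
      block_mx E (b 0 i)%:M 0 (- E) : 'M_((mdim m').+1 + (mdim m').+1)
    else block_mx 0 (q 0)%:M 1%:M 0 : 'M_((mdim m').+1 + (mdim m').+1)
  else 0.

Section Blocks.
Variables (d : nat) (E F : 'M[K]_d) (l l' c : K).
Let Z (x : K) : 'M[K]_(d + d) := block_mx 0 x%:M 1%:M 0.
Let M (E : 'M[K]_d) (x : K) : 'M[K]_(d + d) := block_mx E x%:M 0 (- E).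
Let mxE := (@mul0mx K, @mulmx0 K, @mul1mx K, @mulmx1 K, @add0r, @addr0, @mulNmx K,
  @mulmxN K, @opprK).

Fact block_ZZ : Z l *m Z l = l%:M.
Proof. by rewrite mulmx_block !mxE -scalar_mx_block. Qed.

Fact block_MM : E *m E = c%:M -> M E l *m M E l = c%:M.
Proof.
by move=> EE; rewrite mulmx_block !mxE EE scalar_mxC subrr -scalar_mx_block.
Qed.

Fact block_ZM : Z l *m M E l' + M E l' *m Z l = l'%:M.
Proof.
rewrite !mulmx_block add_block_mx !mxE scalar_mxC addNr subrr.
by rewrite -scalar_mx_block.
Qed.

Fact block_MN : E *m F + F *m E = c%:M ->
  M E l *m M F l' + M F l' *m M E l = c%:M.
Proof.
move=> EF; rewrite !mulmx_block add_block_mx !mxE EF.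
by rewrite ![_ *m _%:M]scalar_mxC addrA subrK subrr -scalar_mx_block.
Qed.
End Blocks.

Lemma mmodel_sq m q b i : (i < m)%N ->
  mmodel m q b i *m mmodel m q b i = (q i)%:M.
Proof.
elim: m q b i => [//|m IHm] q b [_|i lt_im]; first exact: (@block_ZZ (mdim m).+1 (q 0)).
exact: (@block_MM (mdim m).+1 _ _ _ (IHm _ _ _ lt_im)).
Qed.

Lemma mmodel_anti m q b i j : (i < j < m)%N ->
  mmodel m q b i *m mmodel m q b j + mmodel m q b j *m mmodel m q b i
    = (b i j)%:M.
Proof.
elim: m q b i j => [|m IHm] q b [|i] [|j] //=; rewrite ?andbF // => lt_ij.
  exact: (@block_ZM (mdim m).+1).
exact: (@block_MN (mdim m).+1 _ _ _ _ _ (IHm _ _ _ _ lt_ij)).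
Qed.
End MatrixModel.

(* Letters of the Clifford algebra: None is G, Some i is X_i. *)
Section Clifford.
Variables (K : fieldType) (n : nat) (alpha : K) (beta gamma : 'I_n -> K).
Variable lambda : 'I_n -> 'I_n -> K.
Notation term := (aterm K (option 'I_n)).
Notation tG := (AGen None : term).
Notation tX i := (AGen (Some i) : term).

Inductive cl_rel : term -> term -> Prop :=
| cl_GG : cl_rel (AMul tG tG) (AConst alpha)
| cl_XX i : cl_rel (AMul (tX i) (tX i)) (AConst (beta i))
| cl_GX i : cl_rel (AAdd (AMul tG (tX i)) (AMul (tX i) tG)) (AConst (gamma i))
| cl_XY (i j : 'I_n) : (i < j)%N ->
    cl_rel (AAdd (AMul (tX i) (tX j)) (AMul (tX j) (tX i)))
           (AConst (lambda i j)).

Definition clifford : Type := presented cl_rel.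
HB.instance Definition _ := GRing.PzRing.on clifford.
HB.instance Definition _ := GRing.Lmodule.on clifford.

Definition clG : clifford := pgen cl_rel None.
Definition clX i : clifford := pgen cl_rel (Some i).

Section Relations.
Variables (B : algType K) (g : B) (x : 'I_n -> B).

Definition cl_family : Prop :=
  [/\ g * g = alpha%:A,
      forall i, x i * x i = (beta i)%:A,
      forall i, g * x i + x i * g = (gamma i)%:A &
      forall i j : 'I_n, (i < j)%N -> x i * x j + x j * x i = (lambda i j)%:A].

Lemma cl_familyP : cl_family ->
  forall s t, cl_rel s t -> aeval (oapp x g) s = aeval (oapp x g) t.
Proof. by case=> GG XX GX XY s t [] /=. Qed.
End Relations.

Fact clifford_nz : (1 : clifford) != 0.
Proof.
pose ext (T : Type) (d : T) (f : 'I_n -> T) (k : nat) : T := oapp f d (insub k).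
pose q k : K := if k is k'.+1 then ext _ 0 beta k' else alpha.
pose b k l : K := if l is l'.+1 then
  (if k is k'.+1 then ext _ 0 (ext _ (fun=> 0) lambda k') l' else ext _ 0 gamma l')
  else 0.
have extE (T : Type) (d : T) f (i : 'I_n) : ext T d f i = f i.
  by rewrite /ext valK.
pose M := mmodel n.+1 q b.
have fam : cl_family (M 0%N) (fun i : 'I_n => M i.+1).
  have sc c : c%:M = c%:A :> 'M[K]_((mdim n.+1).+1) by rewrite -scalemx1.
  split=> [|i|i|i j lt_ij]; rewrite -sc.
  - exact: mmodel_sq.
  - by rewrite [LHS]mmodel_sq ?ltnS //= extE.
  - by rewrite [LHS]mmodel_anti ?ltnS //= extE.
  - by rewrite [LHS]mmodel_anti ?ltnS ?lt_ij //= !extE.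
apply/eqP => /(congr1 (plift (oapp (fun i : 'I_n => M i.+1) (M 0%N)))).
rewrite plift1; last exact: cl_familyP.
rewrite -[0 in RHS](scale0r (1 : clifford)) pliftZ; last exact: cl_familyP.
by rewrite scale0r; apply/eqP/oner_neq0.
Qed.

HB.instance Definition _ := GRing.PzSemiRing_isNonZero.Build clifford clifford_nz.
HB.instance Definition _ := GRing.Lmodule_isLalgebra.Build K clifford
  (@pscaleAl _ _ cl_rel).
HB.instance Definition _ := GRing.Lalgebra_isAlgebra.Build K clifford
  (@pscaleAr _ _ cl_rel).

Lemma clifford_rel : cl_family clG clX.
Proof.
have rel s t : cl_rel s t -> pcls cl_rel s = pcls cl_rel t.
  by move=> st; apply/pclsP/aeq_rel.
have cst c : c%:A = (pcls cl_rel (AConst c) : clifford).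
  exact: (@pmul1r _ _ cl_rel).
split=> [|i|i|i j lt_ij]; rewrite cst.
- by rewrite -(rel _ _ cl_GG) -pmulE.
- by rewrite -(rel _ _ (cl_XX i)) -pmulE.
- by rewrite -(rel _ _ (cl_GX i)) -paddE -!pmulE.
- by rewrite -(rel _ _ (cl_XY lt_ij)) -paddE -!pmulE.
Qed.

Lemma clifford_ind (P : clifford -> Prop) :
  P 1 -> P clG -> (forall i, P (clX i)) -> (forall c x, P x -> P (c *: x)) ->
  (forall x y, P x -> P y -> P (x + y)) ->
  (forall x y, P x -> P y -> P (x * y)) -> forall x, P x.
Proof.
by move=> P1 PG PX PZ PD PM; apply: presented_ind => // -[i|]; [apply: PX|].
Qed.

Section Lift.
Variables (B : algType K) (g : B) (x : 'I_n -> B) (fam : cl_family g x).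

Definition cl_lift of cl_family g x : clifford -> B := plift (oapp x g).

Let f := cl_lift fam.
Let famP := cl_familyP fam.

Fact cl_lift_linear : linear f.
Proof. by move=> c u v; rewrite /f /cl_lift (pliftD famP) (pliftZ famP). Qed.

Fact cl_lift_monoid : monoid_morphism f.
Proof. by split=> [|u v]; rewrite /f /cl_lift ?(plift1 famP) ?(pliftM famP). Qed.

HB.instance Definition _ :=
  GRing.isLinear.Build K clifford B *:%R (cl_lift fam) cl_lift_linear.
HB.instance Definition _ :=
  GRing.isMonoidMorphism.Build clifford B (cl_lift fam) cl_lift_monoid.

Lemma cl_liftG : cl_lift fam clG = g.
Proof. exact: (plift_gen famP None). Qed.

Lemma cl_liftX i : cl_lift fam (clX i) = x i.
Proof. exact: (plift_gen famP (Some i)). Qed.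
End Lift.
End Clifford.


Section AlgebraMaps.
Variable K : fieldType.

Lemma tliftM (A B C : algType K) (f f' f'' : A -> B -> C) (s t : A ⊗ B) :
  bilinear_map f -> bilinear_map f' -> bilinear_map f'' ->
  (forall a b a' b', f'' (a * a') (b * b') = f a b * f' a' b') ->
  tlift f'' (s * t) = tlift f s * tlift f' t.
Proof.
move=> bf bf' bf'' fM; elim/tensor_ind: s => [|s s' IH IH'|a b].
- by rewrite !mul0r !tlift0 // mul0r.
- by rewrite mulrDl !tliftD // mulrDl IH IH'.
elim/tensor_ind: t => [|t t' IH IH'|a' b'].
- by rewrite !mulr0 !tlift0 // mulr0.
- by rewrite mulrDr !tliftD // mulrDr IH IH'.
by rewrite tensM !tliftE.
Qed.

Lemma tlift_algmap (A B C D : algType K) (phi : {lrmorphism D -> A ⊗ B})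
    (f : A -> B -> C) : bilinear_map f -> f 1 1 = 1 ->
  (forall a b a' b', f (a * a') (b * b') = f a b * f a' b') ->
  linear (fun d => tlift f (phi d)) * monoid_morphism (fun d => tlift f (phi d)).
Proof.
move=> bf f1 fM; split=> [c u v|].
  by rewrite linearP tliftD // tliftZ.
by split=> [|u v]; rewrite ?rmorph1 ?tens1 ?tliftE // rmorphM; apply: tliftM.
Qed.

Lemma clifford_ext n (alpha : K) (beta gamma : 'I_n -> K)
    (lambda : 'I_n -> 'I_n -> K) (B : algType K)
    (F F' : clifford alpha beta gamma lambda -> B) :
  linear F * monoid_morphism F -> linear F' * monoid_morphism F' ->
  F (clG _ _ _ _) = F' (clG _ _ _ _) ->
  (forall i, F (clX _ _ _ _ i) = F' (clX _ _ _ _ i)) -> F =1 F'.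
Proof.
move=> [FL [F1 FM]] [FL' [F1' FM']] FG FX; apply: clifford_ind => //.
- by rewrite F1 F1'.
- have z (H : clifford alpha beta gamma lambda -> B) : linear H -> H 0 = 0.
    move=> HL; have := HL 1 0 0; rewrite !scale1r addr0 => /(congr1 (+%R^~ (- H 0))).
    by rewrite addrK subrr => /esym.
  move=> c x Fx; have := FL c x 0; have := FL' c x 0.
  by rewrite !addr0 !z // !addr0 Fx => -> ->.
- by move=> x y Fx Fy; have := FL 1 x y; have := FL' 1 x y; rewrite !scale1r Fx Fy => -> ->.
- by move=> x y Fx Fy; rewrite FM FM' Fx Fy.
Qed.
End AlgebraMaps.

Notation "'\tsum_' ( u , v <- t ) F" := (tlift (fun u v => F) t)
  (at level 45, u name, v name, t at level 99, F at level 45,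
   format "'[' \tsum_ ( u ,  v  <-  t ) '/  '  F ']'") : ring_scope.

(* Hopf algebras with bijective antipode; antipodeV is the inverse of the
   antipode. *)
Record hopfAlg (K : fieldType) := HopfAlg {
  hopf_sort :> algType K;
  comul : {lrmorphism hopf_sort -> hopf_sort ⊗ hopf_sort};
  counit : {lrmorphism hopf_sort -> K^o};
  antipode : {linear hopf_sort -> hopf_sort};
  antipodeV : {linear hopf_sort -> hopf_sort};
  comulA : forall h : hopf_sort,
    \tsum_(h12, h3 <- comul h) \tsum_(h1, h2 <- comul h12) h1 ⊗ (h2 ⊗ h3)
      = \tsum_(h1, h23 <- comul h) h1 ⊗ comul h23;
  counitl : forall h : hopf_sort, \tsum_(h1, h2 <- comul h) (counit h1 : K) *: h2 = h;
  counitr : forall h : hopf_sort, \tsum_(h1, h2 <- comul h) (counit h2 : K) *: h1 = h;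
  antipodel : forall h : hopf_sort,
    \tsum_(h1, h2 <- comul h) antipode h1 * h2 = (counit h : K)%:A;
  antipoder : forall h : hopf_sort,
    \tsum_(h1, h2 <- comul h) h1 * antipode h2 = (counit h : K)%:A;
  antipodeK : cancel antipode antipodeV;
  antipodeVK : cancel antipodeV antipode
}.

Record comodAlg (K : fieldType) (H : hopfAlg K) := ComodAlg {
  comod_sort :> algType K;
  coact : {lrmorphism comod_sort -> comod_sort ⊗ H};
  coactA : forall a : comod_sort,
    \tsum_(a01, a2 <- coact a) \tsum_(a0, a1 <- coact a01) a0 ⊗ (a1 ⊗ a2)
      = \tsum_(a0, a12 <- coact a) a0 ⊗ comul H a12;
  coact_counit : forall a : comod_sort,
    \tsum_(a0, a1 <- coact a) (counit H a1 : K) *: a0 = a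
}.

Section CanonicalCoaction.
Variables (K : fieldType) (n : nat).

(* The defining relations of E(n) are those of Cl(1, 0, 0, 0). *)
Definition E_alg : algType K :=
  clifford (1 : K) (fun _ : 'I_n => 0) (fun _ => 0) (fun _ _ => 0).
Definition Eg : E_alg := clG _ _ _ _.
Definition Ex i : E_alg := clX _ _ _ _ i.

Let Erel := clifford_rel (1 : K) (fun _ : 'I_n => 0) (fun _ => 0) (fun _ _ => 0).

Lemma EgE : Eg * Eg = 1.
Proof. by case: Erel => -> _ _ _; rewrite scale1r. Qed.

Lemma ExE i : Ex i * Ex i = 0.
Proof. by case: Erel => _ -> _ _; rewrite scale0r. Qed.

Lemma EgxE i : Eg * Ex i = - (Ex i * Eg).
Proof.
by apply/eqP; rewrite -addr_eq0; case: Erel => _ _ -> _; rewrite scale0r.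
Qed.

Lemma ExxE i j : Ex i * Ex j = - (Ex j * Ex i).
Proof.
have lt_case (k l : 'I_n) : (k < l)%N -> Ex k * Ex l + Ex l * Ex k = 0.
  by case: Erel => _ _ _ XY /XY ->; rewrite scale0r.
have [/lt_case/eqP|/lt_case/eqP|/val_inj->] := ltngtP i j.
- by rewrite addr_eq0 => /eqP.
- by rewrite addrC addr_eq0 => /eqP.
by rewrite ExE oppr0.
Qed.

Section Coaction.
Variables (alpha : K) (beta gamma : 'I_n -> K) (lambda : 'I_n -> 'I_n -> K).
Notation Cl := (clifford alpha beta gamma lambda).
Notation G := (clG alpha beta gamma lambda).
Notation X := (clX alpha beta gamma lambda).

Fact coact_family :
  cl_family alpha beta gamma lambda (G ⊗ Eg : Cl ⊗ E_alg)
    (fun i => X i ⊗ Eg + 1 ⊗ Ex i).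
Proof.
have [GG XX GX XY] := clifford_rel alpha beta gamma lambda.
split=> [|i|i|i j lt_ij].
- by rewrite tensM GG EgE tensZl.
- rewrite mulrDl !mulrDr !tensM !mulr1 !mul1r XX EgE ExE EgxE.
  by rewrite tens0r tensNr addr0 subrK tensZl.
- rewrite mulrDl mulrDr !tensM !mulr1 !mul1r EgE EgxE tensNr.
  by rewrite addrACA addNr addr0 -tensDl GX tensZl.
rewrite !mulrDl !mulrDr !tensM !mulr1 !mul1r EgE !EgxE (ExxE j i) !tensNr.
have cancel4 (V : zmodType) (p q r s p' : V) :
    p - q + (r + s) + (p' - r + (q - s)) = p + p'.
  rewrite addrACA [r + s + _]addrACA subrr addr0 [p - q + _]addrACA -opprD.
  by rewrite [r + q]addrC subrK.
by rewrite cancel4 -tensDl XY // tensZl.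
Qed.

Definition cl_coact : {lrmorphism Cl -> Cl ⊗ E_alg} := cl_lift coact_family.

Lemma cl_coactG : cl_coact G = G ⊗ Eg.
Proof. exact: (cl_liftG coact_family). Qed.

Lemma cl_coactX i : cl_coact (X i) = X i ⊗ Eg + 1 ⊗ Ex i.
Proof. exact: (cl_liftX coact_family). Qed.
End Coaction.

(* The comultiplication has the same formulas as the canonical coaction, for
   A = E(n) = Cl(1, 0, 0, 0). *)
Definition E_comul : {lrmorphism E_alg -> E_alg ⊗ E_alg} := cl_coact _ _ _ _.

Fact counit_family : cl_family (1 : K) (fun _ : 'I_n => 0) (fun _ => 0)
  (fun _ _ => 0) (1 : K^o) (fun _ => 0).
Proof. by split=> *; rewrite ?mulr0 ?mul0r ?addr0 ?scale0r // scale1r mulr1. Qed.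

Definition E_counit : {lrmorphism E_alg -> K^o} := cl_lift counit_family.

(* The antipode is an algebra map to the converse ring E^c. *)
Fact antipode_family : cl_family (1 : K) (fun _ : 'I_n => 0) (fun _ => 0)
  (fun _ _ => 0) (Eg : E_alg^c) (fun i => Eg * Ex i).
Proof.
have gxgx i j : (Eg * Ex i) * (Eg * Ex j) = - (Ex i * Ex j).
  by rewrite EgxE mulNr -mulrA [Eg * (_ * _)]mulrA EgE mul1r.
split=> [|i|i|i j _].
- by rewrite -[LHS]/(Eg * Eg) EgE scale1r.
- by rewrite -[LHS]/((Eg * Ex i) * (Eg * Ex i)) gxgx ExE oppr0 scale0r.
- rewrite -[LHS]/((Eg * Ex i) * Eg + Eg * (Eg * Ex i)).
  by rewrite {1}EgxE mulNr -mulrA [Eg * (Eg * _)]mulrA EgE mulr1 mul1r addNr scale0r.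
- rewrite -[LHS]/((Eg * Ex j) * (Eg * Ex i) + (Eg * Ex i) * (Eg * Ex j)).
  by rewrite !gxgx (ExxE i j) opprK addNr scale0r.
Qed.

Fact antipodeV_family : cl_family (1 : K) (fun _ : 'I_n => 0) (fun _ => 0)
  (fun _ _ => 0) (Eg : E_alg^c) (fun i => Ex i * Eg).
Proof.
have xg i : Ex i * Eg = - (Eg * Ex i) by rewrite EgxE opprK.
have [gg xx gx xy] := antipode_family.
split=> [|i|i|i j lt_ij]; rewrite ?xg.
- exact: gg.
- by rewrite mulrNN; apply: xx.
- by rewrite mulrN mulNr -opprD gx scale0r oppr0.
- by rewrite !mulrNN; apply: xy.
Qed.

Definition E_antipode_conv : {lrmorphism E_alg -> E_alg^c} := cl_lift antipode_family.
Definition E_antipodeV_conv : {lrmorphism E_alg -> E_alg^c} := cl_lift antipodeV_family.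

Definition E_antipode (h : E_alg) : E_alg := E_antipode_conv h.
Definition E_antipodeV (h : E_alg) : E_alg := E_antipodeV_conv h.

Fact E_antipode_linear : linear E_antipode.
Proof. exact: (linearP E_antipode_conv). Qed.
Fact E_antipodeV_linear : linear E_antipodeV.
Proof. exact: (linearP E_antipodeV_conv). Qed.
HB.instance Definition _ :=
  GRing.isLinear.Build K E_alg E_alg *:%R E_antipode E_antipode_linear.
HB.instance Definition _ :=
  GRing.isLinear.Build K E_alg E_alg *:%R E_antipodeV E_antipodeV_linear.

Lemma E_comulg : E_comul Eg = Eg ⊗ Eg.
Proof. exact: cl_coactG. Qed.
Lemma E_comulx i : E_comul (Ex i) = Ex i ⊗ Eg + 1 ⊗ Ex i.
Proof. exact: cl_coactX. Qed.
Lemma E_counitg : E_counit Eg = 1.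
Proof. exact: (cl_liftG counit_family). Qed.
Lemma E_counitx i : E_counit (Ex i) = 0.
Proof. exact: (cl_liftX counit_family). Qed.
Lemma E_antipodeg : E_antipode Eg = Eg.
Proof. exact: (cl_liftG antipode_family). Qed.
Lemma E_antipodex i : E_antipode (Ex i) = Eg * Ex i.
Proof. exact: (cl_liftX antipode_family). Qed.
Lemma E_antipode1 : E_antipode 1 = 1.
Proof. exact: (rmorph1 E_antipode_conv). Qed.
Lemma E_antipodeM h k : E_antipode (h * k) = E_antipode k * E_antipode h.
Proof. exact: (rmorphM E_antipode_conv). Qed.
Lemma E_antipodeVg : E_antipodeV Eg = Eg.
Proof. exact: (cl_liftG antipodeV_family). Qed.
Lemma E_antipodeVx i : E_antipodeV (Ex i) = Ex i * Eg.
Proof. exact: (cl_liftX antipodeV_family). Qed.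
Lemma E_antipodeV1 : E_antipodeV 1 = 1.
Proof. exact: (rmorph1 E_antipodeV_conv). Qed.
Lemma E_antipodeVM h k : E_antipodeV (h * k) = E_antipodeV k * E_antipodeV h.
Proof. exact: (rmorphM E_antipodeV_conv). Qed.

Fact E_antipodeK : cancel E_antipode E_antipodeV.
Proof.
apply: clifford_ind => [|||||].
- by rewrite E_antipode1 E_antipodeV1.
- by rewrite E_antipodeg E_antipodeVg.
- by move=> i; rewrite E_antipodex E_antipodeVM E_antipodeVg E_antipodeVx -mulrA EgE mulr1.
- by move=> c h IH; rewrite !linearZ /= IH.
- by move=> h k IHh IHk; rewrite !linearD /= IHh IHk.
- by move=> h k IHh IHk; rewrite E_antipodeM E_antipodeVM IHh IHk.
Qed.

Fact E_antipodeVK : cancel E_antipodeV E_antipode.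
Proof.
apply: clifford_ind => [|||||].
- by rewrite E_antipodeV1 E_antipode1.
- by rewrite E_antipodeVg E_antipodeg.
- by move=> i; rewrite E_antipodeVx E_antipodeM E_antipodeg E_antipodex mulrA EgE mul1r.
- by move=> c h IH; rewrite !linearZ /= IH.
- by move=> h k IHh IHk; rewrite !linearD /= IHh IHk.
- by move=> h k IHh IHk; rewrite E_antipodeVM E_antipodeM IHh IHk.
Qed.

Fact cl_coactA alpha beta gamma lambda
    (a : clifford alpha beta gamma lambda) :
  \tsum_(a01, a2 <- cl_coact _ _ _ _ a) \tsum_(a0, a1 <- cl_coact _ _ _ _ a01)
     a0 ⊗ (a1 ⊗ a2) = \tsum_(a0, a12 <- cl_coact _ _ _ _ a) a0 ⊗ E_comul a12.
Proof.
pose f (a2 : E_alg) (a0 : clifford alpha beta gamma lambda) (a1 : E_alg) :=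
  a0 ⊗ (a1 ⊗ a2).
have bf a2 : bilinear_map (f a2).
  by apply: bilinear_mapP => *; rewrite /f ?tensDl ?tensDr ?tensZl ?tensZr ?tensZl ?tensZr.
pose F (a01 : clifford alpha beta gamma lambda) (a2 : E_alg) :=
  \tsum_(a0, a1 <- cl_coact _ _ _ _ a01) a0 ⊗ (a1 ⊗ a2).
have bF : bilinear_map F.
  apply: bilinear_mapP => *; rewrite /F ?linearD ?linearZ /=.
  - exact: (tliftD (bf _)).
  - by rewrite -tlift_addf; apply: eq_tlift => *; rewrite !tensDr.
  - exact: (tliftZ (bf _)).
  - by rewrite -tlift_scalef; apply: eq_tlift => *; rewrite !tensZr.
pose F' (a0 : clifford alpha beta gamma lambda) (a12 : E_alg) := a0 ⊗ E_comul a12.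
have bF' : bilinear_map F'.
  by apply: bilinear_mapP => *; rewrite /F' ?linearD ?linearZ /= ?tensDl ?tensDr ?tensZl ?tensZr.
apply: (clifford_ext (tlift_algmap _ bF _ _) (tlift_algmap _ bF' _ _)) => [|||||].
- rewrite /F rmorph1.
  by rewrite (tliftE (bf _)).
- move=> a0 b a0' b'; rewrite /F rmorphM.
  by apply: (tliftM _ _ (bf b) (bf b') (bf (b * b'))) => *; rewrite /f !tensM.
- by rewrite /F' rmorph1.
- by move=> *; rewrite /F' rmorphM tensM.
- rewrite cl_coactG !tliftE // /F cl_coactG (tliftE (bf _)) /F'.
  by rewrite E_comulg.
- move=> i; rewrite cl_coactX !tliftD // !tliftE // /F cl_coactX rmorph1.
  rewrite (tliftD (bf _)) !(tliftE (bf _)) /F' E_comulg E_comulx /f.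
  by rewrite tensDr addrA.
Qed.

Fact cl_coact_counit alpha beta gamma lambda
    (a : clifford alpha beta gamma lambda) :
  \tsum_(a0, a1 <- cl_coact _ _ _ _ a) (E_counit a1 : K) *: a0 = a.
Proof.
pose f (a0 : clifford alpha beta gamma lambda) (a1 : E_alg) := (E_counit a1 : K) *: a0.
have bf : bilinear_map f.
  apply: bilinear_mapP => [a0 a0' a1|a0 a1 a1'|c a0 a1|c a0 a1]; rewrite /f.
  - by rewrite scalerDr.
  - by rewrite [E_counit _]linearD scalerDl.
  - by rewrite !scalerA mulrC.
  - by rewrite [E_counit _]linearZ scalerA.
apply: (clifford_ext (tlift_algmap _ bf _ _) (_ : linear id * monoid_morphism id)) => [||||] //.
- by rewrite /f rmorph1 scale1r.
- by move=> a0 b a0' b'; rewrite /f rmorphM -scalerAl -scalerAr scalerA.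
- by rewrite cl_coactG tliftE // /f E_counitg scale1r.
- move=> i; rewrite cl_coactX tliftD // !tliftE // /f E_counitg E_counitx.
  by rewrite scale1r scale0r addr0.
Qed.

Fact E_counitl (h : E_alg) : \tsum_(h1, h2 <- E_comul h) (E_counit h1 : K) *: h2 = h.
Proof.
pose f (h1 h2 : E_alg) := (E_counit h1 : K) *: h2.
have bf : bilinear_map f.
  apply: bilinear_mapP => [a0 a0' a1|a0 a1 a1'|c a0 a1|c a0 a1]; rewrite /f.
  - by rewrite [E_counit _]linearD scalerDl.
  - by rewrite scalerDr.
  - by rewrite [E_counit _]linearZ scalerA.
  - by rewrite !scalerA mulrC.
apply: (clifford_ext (tlift_algmap _ bf _ _) (_ : linear id * monoid_morphism id)) => [||||] //.
- by rewrite /f rmorph1 scale1r.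
- by move=> a0 b a0' b'; rewrite /f rmorphM -scalerAl -scalerAr scalerA.
- by rewrite [E_comul _]E_comulg tliftE // /f E_counitg scale1r.
- move=> i; rewrite [E_comul _]E_comulx tliftD // !tliftE // /f rmorph1 E_counitx.
  by rewrite scale1r scale0r add0r.
Qed.

Fact E_antipodel (h : E_alg) :
  \tsum_(h1, h2 <- E_comul h) E_antipode h1 * h2 = (E_counit h : K)%:A.
Proof.
pose f (w h1 h2 : E_alg) := E_antipode h1 * (w * h2).
have bf w : bilinear_map (f w).
  by apply: bilinear_mapP => *;
    rewrite /f ?linearD ?linearZ /= ?mulrDr ?mulrDl ?mulrDr -?scalerAl -?scalerAr -?scalerAr.
rewrite (@eq_tlift _ _ _ _ _ (f 1)); last by move=> *; rewrite /f mul1r.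
have fM s t : tlift (f 1) (s * t) = tlift (f (tlift (f 1) s)) t.
  elim/tensor_ind: t => [|t t' IH IH'|c d]; first by rewrite mulr0 !tlift0.
    by rewrite mulrDr !tliftD // IH IH'.
  rewrite tliftE //; elim/tensor_ind: s => [|s s' IH IH'|a b].
  - by rewrite mul0r !tlift0 // /f mul0r mulr0.
  - by rewrite mulrDl !tliftD // IH IH' /f mulrDl mulrDr.
  by rewrite tensM !tliftE // /f !mul1r E_antipodeM !mulrA.
elim/clifford_ind: h => [||i|c h IH|h k IHh IHk|h k IHh IHk].
- by rewrite !rmorph1 tliftE // /f E_antipode1 !mul1r scale1r.
- by rewrite [E_comul _]E_comulg tliftE // /f E_antipodeg mul1r EgE [E_counit _]E_counitg scale1r.
- rewrite [E_comul _]E_comulx tliftD // !tliftE // /f E_antipode1 !mul1r.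
  by rewrite E_antipodex EgxE mulNr -mulrA EgE mulr1 addNr [E_counit _]E_counitx scale0r.
- by rewrite !linearZ /= tliftZ // IH scalerA.
- by rewrite !linearD /= tliftD // IHh IHk scalerDl.
- rewrite !rmorphM fM IHh.
  rewrite (@eq_tlift _ _ _ _ _ (fun u v => (E_counit h : K) *: f 1 u v)).
    by rewrite tlift_scalef IHk scalerA.
  by move=> u v; rewrite /f -scalerAl -scalerAr.
Qed.

Fact E_antipoder (h : E_alg) :
  \tsum_(h1, h2 <- E_comul h) h1 * E_antipode h2 = (E_counit h : K)%:A.
Proof.
pose f (w h1 h2 : E_alg) := (h1 * w) * E_antipode h2.
have bf w : bilinear_map (f w).
  by apply: bilinear_mapP => *;
    rewrite /f ?linearD ?linearZ /= ?mulrDl ?mulrDr -?scalerAl -?scalerAr -?scalerAl.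
rewrite (@eq_tlift _ _ _ _ _ (f 1)); last by move=> *; rewrite /f mulr1.
have fM s t : tlift (f 1) (s * t) = tlift (f (tlift (f 1) t)) s.
  elim/tensor_ind: s => [|s s' IH IH'|a b]; first by rewrite mul0r !tlift0.
    by rewrite mulrDl !tliftD // IH IH'.
  rewrite tliftE //; elim/tensor_ind: t => [|t t' IH IH'|c d].
  - by rewrite mulr0 !tlift0 // /f mulr0 mul0r.
  - by rewrite mulrDr !tliftD // IH IH' /f mulrDr mulrDl.
  by rewrite tensM !tliftE // /f !mulr1 E_antipodeM !mulrA.
elim/clifford_ind: h => [||i|c h IH|h k IHh IHk|h k IHh IHk].
- by rewrite !rmorph1 tliftE // /f E_antipode1 !mul1r scale1r.
- by rewrite [E_comul _]E_comulg tliftE // /f E_antipodeg mulr1 EgE [E_counit _]E_counitg scale1r.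
- rewrite [E_comul _]E_comulx tliftD // !tliftE // /f E_antipodeg !mulr1 !mul1r.
  by rewrite E_antipodex EgxE subrr [E_counit _]E_counitx scale0r.
- by rewrite !linearZ /= tliftZ // IH scalerA.
- by rewrite !linearD /= tliftD // IHh IHk scalerDl.
- rewrite !rmorphM fM IHk.
  rewrite (@eq_tlift _ _ _ _ _ (fun u v => (E_counit k : K) *: f 1 u v)).
    by rewrite tlift_scalef IHh scalerA mulrC.
  by move=> u v; rewrite /f -scalerAr -scalerAl.
Qed.

Definition En : hopfAlg K :=
  @HopfAlg K E_alg E_comul E_counit E_antipode E_antipodeV
    (@cl_coactA _ _ _ _) E_counitl (@cl_coact_counit _ _ _ _)
    E_antipodel E_antipoder E_antipodeK E_antipodeVK.

Definition Cl alpha beta gamma lambda : comodAlg En :=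
  @ComodAlg K En (clifford alpha beta gamma lambda) (cl_coact _ _ _ _)
    (@cl_coactA _ _ _ _) (@cl_coact_counit _ _ _ _).
End CanonicalCoaction.

Section Integrals.
Variables (K : fieldType) (H : hopfAlg K) (A : comodAlg H).

(* H^op has the same underlying vector space as H, so A (x) H^op is written
   A ⊗ H; all products below are those of A, H and A ⊗ H. *)
Definition psi (h : H) (t : A ⊗ H) : (A ⊗ H) ⊗ H :=
  \tsum_(a, l <- t) \tsum_(a0, a1 <- coact A a) \tsum_(l1, l2 <- comul H l)
    (a0 ⊗ l1) ⊗ (l2 * h * a1).

Definition is_integral (T : {linear H -> (A ⊗ H)%type}) : Prop :=
  (forall h : H, \tsum_(h1, h2 <- comul H h) psi h1 (T h2) = T h ⊗ (1 : H)) /\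
  (forall (a : A) (h : H),
     \tsum_(a0, a123 <- coact A a) \tsum_(a1, a23 <- comul H a123)
       \tsum_(a2, a3 <- comul H a23)
         ((a0 ⊗ 1) * T (antipodeV H a2 * h * a1) * (1 ⊗ antipodeV H a3))
     = \tsum_(a0, a1 <- coact A a) ((1 ⊗ antipodeV H a1) * T h * (a0 ⊗ 1))).

Definition is_total_integral (T : {linear H -> (A ⊗ H)%type}) : Prop :=
  is_integral T /\ T 1 = 1 ⊗ 1.
End Integrals.

(* Products over i in P are taken in increasing order of i : 'I_n. *)
Definition ExP K n (P : {set 'I_n}) : E_alg K n := \prod_(i in P) Ex K i.
Definition clXP (K : fieldType) n (alpha : K) (beta gamma : 'I_n -> K)
    (lambda : 'I_n -> 'I_n -> K) (P : {set 'I_n}) :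
    clifford alpha beta gamma lambda :=
  \prod_(i in P) clX alpha beta gamma lambda i.

(* The exponent s(F, P) for F \subset P: [enum P] lists P in increasing order,
   so (index i (enum P)).+1 is the 1-based position of i in P. The subtraction
   is then never truncated, as the positions are distinct and positive. *)
Definition s_exp n (F P : {set 'I_n}) : nat :=
  ((\sum_(i in F) (index i (enum P)).+1) - (#|F| * #|F|.+1)./2)%N.

(* Main.v *)
Require Import Defs.
From HB Require Import structures.
From mathcomp Require Import all_boot all_algebra.
Import GRing.Theory.
Local Open Scope ring_scope.

(** Applying the counit of E(n) to the second tensor factor kills every term
    with F nonempty and leaves the sum of the ±eta(k, Q) G^k X_Q, so everything
    reduces to the linear independence of the G^k X_Q in the Clifford algebra.
    That follows from the block matrix representation [mmodel]: its ordered
    monomials send a fixed vector to pairwise orthogonal vectors. *)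

Section MatrixMonomials.
Variable K : fieldType.

(** A standard basis vector in dimension 2^m: the membership bits of [S] are read as binary digits,
    [S ord0] choosing between the upper and lower half, to match the block recursion of [mmodel]. *)
Fixpoint monomial_vec m : pred 'I_m -> 'cV[K]_((mdim m).+1) :=
  match m return pred 'I_m -> 'cV[K]_((mdim m).+1) with
  | 0 => fun _ => const_mx 1
  | m'.+1 => fun S =>
      let v := monomial_vec m' (fun i => S (lift ord0 i)) in
      (if S ord0 then col_mx 0 v else col_mx v 0)
        : 'cV_((mdim m').+1 + (mdim m').+1)
  end.

Lemma eq_monomial_vec m (S S' : pred 'I_m) :
  S =1 S' -> monomial_vec m S = monomial_vec m S'.
Proof.
elim: m S S' => [//|m IHm] S S' eqS /=.
by rewrite eqS (IHm _ (fun i => S' (lift ord0 i))) // => i; apply: eqS.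
Qed.

Lemma col_mx_dot d (u v u' v' : 'cV[K]_d) :
  (col_mx u v)^T *m col_mx u' v' = u^T *m u' + v^T *m v'.
Proof. by rewrite tr_col_mx mul_row_col. Qed.

(** Vectors whose first bits differ live in complementary halves; otherwise the product is that of
    the shorter vectors. *)
Lemma monomial_vec_dot m (S S' : pred 'I_m) :
  (monomial_vec m S)^T *m monomial_vec m S' = [forall i, S i == S' i]%:R%:M.
Proof.
elim: m S S' => [|m IHm] S S'.
  have -> : [forall i, S i == S' i] by apply/forallP => -[].
  apply/matrixP => i j; rewrite !ord1 !mxE big_ord1 !mxE mulr1.
  by rewrite eqxx.
have -> : [forall i, S i == S' i] =
    (S ord0 == S' ord0) &&
    [forall i : 'I_m, S (lift ord0 i) == S' (lift ord0 i)].
  apply/forallP/andP => [eqS|[eq0 /forallP eqS] i].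
    by split; [apply: eqS | apply/forallP => i; apply: eqS].
  by case: (unliftP ord0 i) => [j|] ->.
rewrite /=; case: (S ord0); case: (S' ord0);
  by rewrite [LHS](@col_mx_dot (mdim m).+1) ?trmx0 ?mul0mx ?mulmx0 ?add0r ?addr0
    ?IHm //= -scalemx1 scale0r.
Qed.

(** The rightmost factors act first, so each factor meets a vector on which its scalar blocks from
    [q] and [b] multiply only zeros. The parameters drop out and each factor just switches on its
    own bit. *)
Lemma prod_mmodel_vec m (q : nat -> K) b (S : pred 'I_m) :
  (\prod_(i < m | S i) mmodel m q b i) *m monomial_vec m xpred0 =
    monomial_vec m S.
Proof.
elim: m q b S => [|m IHm] q b S; first by rewrite big_ord0 mul1mx.
pose d := (mdim m).+1.
(* Factors of positive index are block upper triangular: they preserve the upper half and act there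
   as the smaller model with shifted parameters. *)
have shift : (\prod_(i < m | S (lift ord0 i)) mmodel m.+1 q b (lift ord0 i))
      *m monomial_vec m.+1 xpred0 =
    col_mx (monomial_vec m (fun i => S (lift ord0 i))) 0
    :> 'cV_((mdim m).+1 + (mdim m).+1).
  rewrite -(IHm (q \o succn) (fun i j => b i.+1 j.+1)) /=.
  pose v := monomial_vec m xpred0.
  elim/big_rec2: _ => [|i M N _ IH]; first by rewrite !mul1mx.
  rewrite -[_ * N]/(_ *m N) -[_ * M]/(_ *m M) -!mulmxA IH.
  by rewrite [LHS](@mul_block_col _ d d d d) !mulmx0 !mul0mx !addr0.
rewrite big_mkcond big_ord_recl -big_mkcond.
rewrite -[X in X *m _]/(_ *m _) -mulmxA [X in _ *m X]shift /=.
(* The factor of index 0 acts last and carries the upper half to the lower one. *)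
case: (S ord0); last by rewrite mul1mx.
by rewrite [LHS](@mul_block_col _ d d d d) mul0mx !mulmx0 mul1mx !addr0.
Qed.
End MatrixMonomials.

Section CliffordCoordinates.
Variables (K : fieldType) (n : nat) (alpha : K) (beta gamma : 'I_n -> K).
Variable lambda : 'I_n -> 'I_n -> K.
Notation Cl := (clifford alpha beta gamma lambda).
Notation G := (clG alpha beta gamma lambda).
Notation X := (clX alpha beta gamma lambda).

(* [mmodel] takes its parameters on nat: 0 stands for G, and i.+1 for X_i. *)
Let q (k : nat) : K := if k is i.+1 then oapp beta 0 (insub i) else alpha.
Let b (k l : nat) : K :=
  if l isn't j.+1 then 0 else
  if k is i.+1 then
    oapp (fun i => oapp (lambda i) 0 (insub j)) 0 (insub i)
  else oapp gamma 0 (insub j).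
Notation M := (mmodel n.+1 q b).

Lemma mmodel_family :
  cl_family alpha beta gamma lambda (M 0%N) (fun i : 'I_n => M i.+1).
Proof.
split=> [|i|i|i j lt_ij]; rewrite scalemx1.
- exact: mmodel_sq.
- by rewrite [LHS]mmodel_sq ?ltnS //= valK.
- by rewrite [LHS]mmodel_anti ?ltnS //= valK.
- by rewrite [LHS]mmodel_anti ?ltnS ?lt_ij //= !valK.
Qed.

(** Index 0 records the exponent of [G] and index i + 1 the membership of i in [Q], so that G^k X_Q
    becomes one ordered product over n + 1 letters. *)
Let S (k : 'I_2) (Q : {set 'I_n}) (i : 'I_n.+1) : bool :=
  oapp (mem Q) (k == 1%N :> nat) (unlift ord0 i).

Lemma cl_lift_monomial (k : 'I_2) (Q : {set 'I_n}) :
  cl_lift mmodel_family (G ^+ k * clXP alpha beta gamma lambda Q) =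
    \prod_(i < n.+1 | S k Q i) M i.
Proof.
rewrite rmorphM rmorphXn rmorph_prod [X in X ^+ _](cl_liftG mmodel_family).
rewrite [RHS]big_mkcond big_ord_recl -big_mkcond; congr (_ * _).
  by rewrite /S unlift_none; case: k => -[|[]].
apply: eq_big => [i|i _]; first by rewrite /S liftK.
exact: (cl_liftX mmodel_family).
Qed.

(** The dual coordinate is a matrix coefficient: act on the vector of the empty set, then pair with
    the vector of [S k Q]. *)
Lemma clifford_coord (k : 'I_2) (Q : {set 'I_n}) :
  exists phi : {linear Cl -> K^o}, forall (k' : 'I_2) Q',
    phi (G ^+ k' * clXP alpha beta gamma lambda Q') =
      ((k' == k) && (Q' == Q))%:R.
Proof.
pose phi (a : Cl) : K^o :=
  ((monomial_vec K n.+1 (S k Q))^T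
     *m (cl_lift mmodel_family a *m monomial_vec K n.+1 xpred0)) 0 0.
have phiL : linear phi.
  by move=> c u v; rewrite /phi linearP mulmxDl -scalemxAl mulmxDr -scalemxAr !mxE.
pose phiLM := GRing.isLinear.Build K Cl K^o *:%R phi phiL.
pose phi' : {linear Cl -> K^o} := HB.pack phi phiLM.
exists phi' => k' Q'.
rewrite -[LHS]/(phi _) /phi cl_lift_monomial prod_mmodel_vec monomial_vec_dot mxE eqxx mulr1n.
congr (nat_of_bool _)%:R; apply/forallP/andP => [eqS|[/eqP-> /eqP->] //].
split; apply/eqP.
  (* Index 0 tests only whether the exponent is 1, which determines an element of ['I_2]. *)
  have := eqS ord0; rewrite /S unlift_none /=.
  by case: k k' {eqS phi phiL phiLM phi'} => -[|[|//]] ? [[|[|//]] ?] //= _; apply: val_inj.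
apply/setP => i; have := eqS (lift ord0 i).
by rewrite /S liftK /= => /eqP ->.
Qed.
End CliffordCoordinates.

Lemma E_counit_monomial (K : fieldType) n m (F : {set 'I_n}) :
  E_counit K n (Eg K n ^+ m * ExP K F) = (F == set0)%:R.
Proof.
rewrite rmorphM rmorphXn rmorph_prod [X in X ^+ _](E_counitg K n) expr1n mul1r.
have [->|/set0Pn[i iF]] := eqVneq F set0; first by rewrite big_set0.
by rewrite (bigD1 i) //= [X in X * _](E_counitx K) mul0r.
Qed.

(** The functional is the Clifford coordinate times the counit, which sends g to 1 and each x_i to
    0. *)
Lemma tensor_coord (K : fieldType) n (alpha : K) (beta gamma : 'I_n -> K)
    (lambda : 'I_n -> 'I_n -> K) (k : 'I_2) (Q : {set 'I_n}) :
  exists L : {linear (clifford alpha beta gamma lambda ⊗ E_alg K n)%type -> K^o},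
    forall (k' : 'I_2) (Q' : {set 'I_n}) m (F : {set 'I_n}),
      L ((clG alpha beta gamma lambda ^+ k' * clXP alpha beta gamma lambda Q')
           ⊗ (Eg K n ^+ m * ExP K F)) =
        ((k' == k) && (Q' == Q) && (F == set0))%:R.
Proof.
have [phi phiE] := clifford_coord K n alpha beta gamma lambda k Q.
pose f (a : clifford alpha beta gamma lambda) (h : E_alg K n) : K^o :=
  (E_counit K n h : K) *: phi a.
have bf : bilinear_map f.
  apply: bilinear_mapP => *; rewrite /f.
  - by rewrite linearD scalerDr.
  - by rewrite linearD scalerDl.
  - by rewrite linearZ !scalerA mulrC.
  - by rewrite linearZ scalerA.
pose fLM := GRing.isLinear.Build K _ K^o *:%R (tlift f) (tlift_is_linear bf).
pose L : {linear _ -> K^o} := HB.pack (tlift f) fLM.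
exists L => k' Q' m F; rewrite [LHS](tliftE bf) /f phiE E_counit_monomial.
by case: (F == set0); rewrite ?andbT ?andbF ?scale1r ?scale0r.
Qed.

Lemma s_exp0 n : s_exp (set0 : {set 'I_n}) set0 = 0%N.
Proof. by rewrite /s_exp big_set0. Qed.

Theorem corollary4p12 (K : fieldType) (char2 : 2%N \notin [pchar K])
    (n : nat) (n_ge1 : (1 <= n)%N)
    (alpha : K) (beta gamma : 'I_n -> K) (lambda : 'I_n -> 'I_n -> K)
    (T : {linear En K n -> (Cl alpha beta gamma lambda ⊗ En K n)%type})
    (eta : 'I_2 -> {set 'I_n} -> K) :
  is_integral T ->
  T 1 = \sum_(k < 2) \sum_(Q : {set 'I_n}) \sum_(F : {set 'I_n} | F \subset Q)
          (eta k Q * (-1) ^+ (s_exp (Q :\: F) Q + (#|Q| + k) * #|F|)) *: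
            ((clG alpha beta gamma lambda ^+ k
                * clXP alpha beta gamma lambda (Q :\: F))
              ⊗ (Eg K n ^+ (#|Q| + k) * ExP K F)) ->
  is_total_integral T <->
    (eta ord0 set0 = 1 /\
     forall (k : 'I_2) (Q : {set 'I_n}), (k, Q) <> (ord0, set0) -> eta k Q = 0).
Proof.
move=> intT T1; split=> [[_ Tot]|[eta1 eta0]]; last first.
  split=> //; rewrite T1 (bigD1 ord0) //= [X in _ + X]big1 => [|k k0]; last first.
    rewrite big1 // => Q _; rewrite big1 // => F _.
    by rewrite eta0 ?mul0r ?scale0r // => -[kE]; rewrite kE eqxx in k0.
  rewrite addr0 (bigD1 set0) //= [X in _ + X]big1 => [|Q Q0]; last first.
    rewrite big1 // => F _.
    by rewrite eta0 ?mul0r ?scale0r // => -[QE]; rewrite QE eqxx in Q0.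
  rewrite addr0 (big_pred1 set0) => [|F]; last by rewrite subset0.
  rewrite eta1 setD0 s_exp0 cards0 muln0 addn0 !expr0 mul1r scale1r !mul1r.
  by rewrite /clXP /ExP !big_set0.
have etaE k Q : eta k Q * (-1) ^+ s_exp Q Q = ((ord0 == k) && (set0 == Q))%:R.
  have [L LE] := tensor_coord K n alpha beta gamma lambda k Q.
  (* The unit is the monomial with exponents 0 and both index sets empty. *)
  have <- : L (1 ⊗ 1) = ((ord0 == k) && (set0 == Q))%:R.
    have := LE ord0 set0 0 set0; rewrite eqxx andbT => <-.
    by rewrite /clXP /ExP !big_set0 !mulr1.
  move: Tot => /(congr1 L) <-; rewrite T1.
  rewrite linear_sum (bigD1 k) //= [X in _ + X]big1 => [|k' k'k]; last first.
    rewrite linear_sum big1 // => Q' _; rewrite linear_sum big1 // => F _.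
    by rewrite linearZ /= LE (negPf k'k) scaler0.
  rewrite addr0 linear_sum (bigD1 Q) //= [X in _ + X]big1 => [|Q' Q'Q]; last first.
    rewrite linear_sum big1 // => F _; rewrite linearZ /= LE.
    (* For Q' other than Q, the set Q' minus F may still equal Q, but then F is nonempty and the
       counit kills the term. *)
    have [->|_] := eqVneq F set0; last by rewrite andbF scaler0.
    by rewrite setD0 (negPf Q'Q) andbF scaler0.
  rewrite addr0 linear_sum (bigD1 set0) ?sub0set //=.
  rewrite [X in _ + X]big1 => [|F /andP[_ F0]].
    by rewrite addr0 linearZ /= LE setD0 !eqxx cards0 muln0 addn0 [RHS]mulr1.
  by rewrite linearZ /= LE (negPf F0) andbF scaler0.
split=> [|k Q kQ]; first by have := etaE ord0 set0; rewrite s_exp0 mulr1 !eqxx.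
have := etaE k Q; case: andP => [[/eqP k0 /eqP Q0]|_ /eqP]; first by case: kQ; rewrite -k0 -Q0.
(* The sign is nonzero, so it cancels whatever its exponent. *)
by rewrite mulf_eq0 signr_eq0 orbF => /eqP.
Qed.
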